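(* Let $A$ be the transpose of the Jacobian matrix $\big(\partial y_i/\partial x_j\big)_{1\le i,j\le n}$. Then $$\det A=(-1)^{n-1}\,d\,r^{\,n-1}\,(n-1)!\;\prod_{i=1}^n x_i^{\,d-1}\prod_{1\le i<j\le n}(x_j^r-x_i^r).$$ In particular $\det A=c\,\Delta$ for some nonzero constant $c$, and $\widetilde{\mathcal O}_X$ is a $\widetilde{\mathcal D}_Y$-module.
   Context: Let $r,p,n\ge 1$ be integers with $p\mid r$ and put $d=r/p$. The complex reflection group $G(r,p,n)$ consists of the $n\times n$ monomial matrices whose nonzero entries are $r$-th roots of unity and such that the $d$-th power of the product of the nonzero entries is $1$. Its fundamental invariants in $\mathbb{C}[x_1,\dots,x_n]$ are taken to be $y_j=\sum_{i=1}^n x_i^{jr}$ for $1\le j\le n-1$ and $y_n=(x_1\cdots x_n)^d$. The polynomial discriminant of $G(r,p,n)$ is $\Delta=\prod_s\alpha_s$, the product over all reflections $s$ of $G(r,p,n)$ of a linear form $\alpha_s$ that is an eigenvector of $s$ with nontrivial eigenvalue; it is defined up to a nonzero scalar, and $\Delta=c_0\prod_{i=1}^n x_i^{d-1}\prod_{1\le i<j\le n}(x_i^r-x_j^r)$ with $c_0$ a nonzero constant. Put $\widetilde{\mathcal O}_X=\mathbb{C}[x_1,\dots,x_n,\Delta^{-1}]$ and $\widetilde{\mathcal D}_Y=\mathbb{C}\langle y_1,\dots,y_n,\partial/\partial y_1,\dots,\partial/\partial y_n,\Delta^{-2}\rangle$. In the module structure, $\partial/\partial y_j$ acts as $\sum_i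 (A^{-1})_{ji}\,\partial/\partial x_i$. *)

(* Defs.v *)
From HB Require Import structures.
From mathcomp Require Import all_boot all_order all_algebra.
From mathcomp Require Import boolp functions reals complex.
From mathcomp Require Import mpoly.

Set Implicit Arguments.
Unset Strict Implicit.
Unset Printing Implicit Defensive.

Import GRing.Theory.
Local Open Scope ring_scope.
Local Open Scope complex_scope.
Local Open Scope quotient_scope.

Definition lmod_structure (A : pzRingType) (V : nmodType) : Type :=
  GRing.Nmodule_isLSemiModule A V.

Definition lmod_act (A : pzRingType) (V : nmodType) (M : lmod_structure A V) :
  A -> V -> V := GRing.Nmodule_isLSemiModule.scale M.

Section ReflectionGroup.
Variables (R : realType) (n : nat).
Implicit Types (g s : 'M[R[i]]_n) (f Delta : {mpoly R[i][n]}).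

Definition monomial_mx g : bool :=
  [forall i, #|[set j | g i j != 0]| == 1%N] &&
  [forall j, #|[set i | g i j != 0]| == 1%N].

Definition Grpn (r p : nat) g : Prop :=
  [/\ monomial_mx g,
      forall i j, g i j != 0 -> g i j ^+ r = 1 &
      (\prod_i \prod_(j | g i j != 0) g i j) ^+ (r %/ p) = 1].

(* A reflection fixes a hyperplane pointwise and is not the identity. *)
Definition reflection (r p : nat) s : Prop :=
  Grpn r p s /\ \rank (s - 1%:M) = 1%N.

(* (g . f)(v) = f (g^-1 v), with v the column vector of coordinates. *)
Definition mpoly_act g f : {mpoly R[i][n]} :=
  f \mPo [tuple \sum_j invmx g i j *: 'X_j | i < n].

Definition root_form s (alpha : {mpoly R[i][n]}) : Prop :=
  [/\ alpha != 0, alpha \is 1.-homog &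
      exists2 lambda : R[i],
        lambda != 1 & mpoly_act s alpha = lambda *: alpha].

(* The forms alpha s are only determined up to a scalar: every choice of them
   gives a discriminant. *)
Definition discriminant (r p : nat) Delta : Prop :=
  exists (refls : seq 'M[R[i]]_n) (alpha : 'M[R[i]]_n -> {mpoly R[i][n]}),
    [/\ uniq refls,
        forall s, s \in refls <-> reflection r p s,
        forall s, s \in refls -> root_form s (alpha s) &
        Delta = \prod_(s <- refls) alpha s].

(* The index j : 'I_n stands for j.+1 in y_1, ..., y_n. *)
Definition yinv (r p : nat) (j : 'I_n) : {mpoly R[i][n]} :=
  if j.+1 == n then (\prod_i 'X_i) ^+ (r %/ p)
  else \sum_i 'X_i ^+ (j.+1 * r).

Definition jacobian (r p : nat) : 'M[{mpoly R[i][n]}]_n :=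
  \matrix_(i, j) mderiv j (yinv r p i).

End ReflectionGroup.

Notation Kx R n := {fraction {mpoly (complex R)[n]}}.

Section FunctionField.
Variables (R : realType) (n : nat).
Local Notation Kx := (Kx R n).

Definition constK (c : R[i]) : Kx := tofrac c%:MP.

(* The partial derivative in x_i on C(x), by the quotient rule. *)
Definition xderiv (i : 'I_n) (f : Kx) : Kx :=
  let a := \n_(repr f) in let b := \d_(repr f) in
  tofrac (mderiv i a * b - a * mderiv i b) / tofrac (b ^+ 2).

Definition derivationK (P : Kx -> Kx) : Prop :=
  [/\ forall f g, P (f + g) = P f + P g,
      forall c f, P (constK c * f) = constK c * P f &
      forall f g, P (f * g) = P f * g + f * P g].

(* The partial derivative in y_j on C(y), uniquely extended to its finite
   extension C(x). *)
Definition is_dy (r p : nat) (j : 'I_n) (P : Kx -> Kx) : Prop :=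
  derivationK P /\ forall k, P (tofrac (yinv R r p k)) = (j == k)%:R.

End FunctionField.

Section OX.
Variables (R : realType) (n : nat) (Delta : {mpoly R[i][n]}).

Definition inOX (f : Kx R n) : Prop :=
  exists (a : {mpoly R[i][n]}) (k : nat), f = tofrac a / tofrac Delta ^+ k.

Definition OXpred : {pred Kx R n} := fun f => `[< inOX f >].

Fact OX_subring : subring_closed OXpred.
Proof.
split.
- by apply/asboolP; exists 1, 0%N; rewrite expr0 divr1 rmorph1.
- move=> _ _ /asboolP[a [k ->]] /asboolP[b [l ->]]; apply/asboolP.
  have [D0|D0] := eqVneq (tofrac Delta) 0.
    pose e (k : nat) : {mpoly R[i][n]} := (k == 0%N)%:R.
    have eE m : (tofrac Delta ^+ m)^-1 = tofrac (e m).
      rewrite D0 expr0n /e rmorph_nat.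
      by case: (m == 0%N); rewrite ?invr1 ?invr0.
    exists (a * e k - b * e l), 0%N.
    by rewrite expr0 divr1 !eE rmorphB !rmorphM.
  exists (a * Delta ^+ l - b * Delta ^+ k), (k + l)%N.
  rewrite rmorphB !rmorphM !rmorphXn /=.
  by rewrite -!mulNr addf_div ?expf_neq0 // exprD.
- move=> _ _ /asboolP[a [k ->]] /asboolP[b [l ->]]; apply/asboolP.
  exists (a * b), (k + l)%N.
  by rewrite mulf_div -exprD rmorphM.
Qed.

HB.instance Definition _ := GRing.isSubringClosed.Build (Kx R n) OXpred
  OX_subring.

(* C[x_1, ..., x_n, Delta^-1], inside C(x). *)
Record OX : Type := MkOX { OXval :> Kx R n; _ : OXval \in OXpred }.

HB.instance Definition _ := [isSub for OXval].
HB.instance Definition _ := [Choice of OX by <:].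
HB.instance Definition _ := [SubChoice_isSubComNzRing of OX by <:].

End OX.

Section DY.
Variables (R : realType) (n r p : nat) (Delta : {mpoly R[i][n]}).

(* C<y_1, ..., y_n, d/dy_1, ..., d/dy_n, Delta^-2>, as the algebra of
   operators on C(x) generated by the y_j, the d/dy_j and Delta^-2: the
   square of Delta need not be a polynomial in the y_j (when d > 2), but it is
   always an element of C(x). *)
Inductive inDY : (Kx R n -> Kx R n) -> Prop :=
  | DY_y j : inDY (fun f => tofrac (yinv R r p j) * f)
  | DY_dy j P of is_dy r p j P : inDY P
  | DY_disc : inDY (fun f => tofrac Delta ^- 2 * f)
  | DY_const c : inDY (fun f => constK n c * f)
  | DY_add P Q of inDY P & inDY Q : inDY (fun f => P f + Q f)
  | DY_comp P Q of inDY P & inDY Q : inDY (fun f => P (Q f)).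

Definition DYpred : {pred Kx R n -> Kx R n} := fun P => `[< inDY P >].

Fact DY_zmod : zmod_closed DYpred.
Proof.
split.
- apply/asboolP;
  suff -> : 0 = (fun f : Kx R n => constK n 0 * f) by exact: DY_const.
  by apply/funext => f; rewrite /constK mpolyC0 rmorph0 mul0r.
- move=> P Q /asboolP hP /asboolP hQ; apply/asboolP.
  suff -> : P - Q = (fun f => P f + constK n (-1) * Q f).
    exact: DY_add hP (DY_comp (DY_const _) hQ).
  apply/funext => f.
  by rewrite /constK mpolyCN mpolyC1 rmorphN1 mulN1r.
Qed.

HB.instance Definition _ := GRing.isZmodClosed.Build (Kx R n -> Kx R n) DYpred
  DY_zmod.

Record DY : Type := MkDY { DYval :> Kx R n -> Kx R n; _ : DYval \in DYpred }.

HB.instance Definition _ := [isSub for DYval].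
HB.instance Definition _ := [Choice of DY by <:].
HB.instance Definition _ := [SubChoice_isSubZmodule of DY by <:].

Fact DY_additive (P : DY) f g : P (f + g) = P f + P g.
Proof.
case: P => P /= /asboolP hP.
elim: hP f g => [j|j {}P [[]]//| |c|{}P Q _ IP _ IQ|{}P Q _ IP _ IQ] f g;
  rewrite ?mulrDr //.
- by rewrite IP IQ addrACA.
- by rewrite IQ IP.
Qed.

Fact DY_one_subproof : (fun f : Kx R n => f) \in DYpred.
Proof.
apply/asboolP.
suff -> : (fun f : Kx R n => f) = (fun f => constK n 1 * f) by exact: DY_const.
by apply/funext => f; rewrite /constK mpolyC1 rmorph1 mul1r.
Qed.

Fact DY_mul_subproof (P Q : DY) : (fun f => P (Q f)) \in DYpred.
Proof.
have /asboolP hP := valP P; have /asboolP hQ := valP Q.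
by apply/asboolP; exact: DY_comp hP hQ.
Qed.

Definition DY_one : DY := MkDY DY_one_subproof.
Definition DY_mul (P Q : DY) : DY := MkDY (DY_mul_subproof P Q).

Fact DY_mulA : associative DY_mul.
Proof. by move=> P Q S; apply/val_inj. Qed.
Fact DY_mul1 : left_id DY_one DY_mul.
Proof. by move=> P; apply/val_inj. Qed.
Fact DY_1mul : right_id DY_one DY_mul.
Proof. by move=> P; apply/val_inj. Qed.
Fact DY_mulDl : left_distributive DY_mul +%R.
Proof. by move=> P Q S; apply/val_inj. Qed.
Fact DY_mulDr : right_distributive DY_mul +%R.
Proof.
by move=> P Q S; apply/val_inj/funext => f; exact: DY_additive.
Qed.

HB.instance Definition _ := GRing.Zmodule_isPzRing.Build DY
  DY_mulA DY_mul1 DY_1mul DY_mulDl DY_mulDr.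

End DY.

(* Main.v *)
Require Import Defs.
From HB Require Import structures.
From mathcomp Require Import all_boot all_order all_algebra.
From mathcomp Require Import boolp functions reals complex.
From mathcomp Require Import mpoly.
From mathcomp Require Import perm separable cyclotomic ring.

(** Multiplying the derivative in x_i by x_i makes every monomial an eigenvector.
    Doing this in each row of A turns A into a Vandermonde matrix in the x_i^r, up
    to scalar factors and to the position of its column of ones; this gives the
    determinant (mulX_det_invariant_jacobian, det_invariant_jacobian).

    For the comparison with the discriminant, a reflection s satisfies
    s = 1 + v w with v a column and w a row, and its root is w up to a scalar
    (root_form_rank1). A monomial matrix of this shape is either diagonal with a
    single entry different from 1, or a transposition matrix whose two entries
    outside the diagonal are u and u^-1 (rank1_monomial_classify). Inside G(r,p,n)
    there are d - 1 reflections of the first kind for each i, with root x_i, and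
    one of the second kind for each i < j and each r-th root of unity u, with root
    x_i - u x_j. Since the product of the x_i - u x_j over u is x_i^r - x_j^r, the
    product of all roots has, up to a scalar, the same factors as the determinant
    (discriminant_proportional).

    For the module structure, a derivation of C(x) is determined by its values on
    the variables (frac_derivation_eq), hence is a combination of the d/dx_i. Being
    dual to the y_k then means that its coefficients are a row of the inverse of A
    (dual_derivationE), and Cramer's rule writes this row with the single
    denominator det A = c Delta. So d/dy_j maps C[x, 1/Delta] into itself
    (dual_derivation_localized), as do the other generators of the algebra of
    differential operators (DY_stable); the module laws are then those of
    the composition of operators. *)

Set Implicit Arguments.
Unset Strict Implicit.
Unset Printing Implicit Defensive.

Import GRing.Theory Num.Theory.
Local Open Scope ring_scope.
Local Open Scope complex_scope.

(** * The determinant of the Jacobian matrix *)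

Lemma mpolyXU_neq0 (F : comNzRingType) (n : nat) (i : 'I_n) :
  'X_i != 0 :> {mpoly F[n]}.
Proof.
apply/eqP => /(congr1 (meval (fun=> 1))).
by rewrite mevalXU meval0; apply/eqP/oner_neq0.
Qed.

Section EulerIdentities.
Variables (F : comNzRingType) (n : nat).
Implicit Types (i j : 'I_n) (f g : {mpoly F[n]}).

Lemma mderivXU i j : mderiv i ('X_j : {mpoly F[n]}) = (i == j)%:R.
Proof.
rewrite mderivX mnm1E eq_sym; case: eqP => [->|_]; last by rewrite scale0r.
by rewrite -{1}[U_(j)%MM]add0m addmK mpolyX0 scale1r.
Qed.

Lemma mderiv_exp i f k : mderiv i (f ^+ k) = k%:R * f ^+ k.-1 * mderiv i f.
Proof.
elim: k => [|k IH]; first by rewrite expr0 -mpolyC1 mderivC !mul0r.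
rewrite exprS mderivM IH /= -[k.+1]add1n natrD.
case: k {IH} => [|k]; rewrite /= ?exprS ?expr0; ring.
Qed.

Lemma mulX_mderiv_exp i j k :
  'X_i * mderiv i ('X_j ^+ k) = (i == j)%:R * (k%:R * 'X_j ^+ k) :> {mpoly F[n]}.
Proof.
rewrite mderiv_exp mderivXU; case: eqP => [->|_]; last by rewrite !mulr0 mul0r.
case: k => [|k]; first by rewrite !mul0r !mulr0.
by rewrite /= mulr1 mul1r exprS mulrCA.
Qed.

Lemma mulX_mderiv_prod i (P : pred 'I_n) :
  'X_i * mderiv i (\prod_(j | P j) 'X_j) = (P i)%:R * \prod_(j | P j) 'X_j
    :> {mpoly F[n]}.
Proof.
have nul (Q : pred 'I_n) : ~~ Q i ->
    mderiv i (\prod_(j | Q j) 'X_j : {mpoly F[n]}) = 0.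
  move=> Qi; elim/big_ind : _ => [|f g Df Dg|j Qj].
  - by rewrite -mpolyC1 mderivC.
  - by rewrite mderivM Df Dg mul0r mulr0 addr0.
  - by rewrite mderivXU (_ : i == j = false) //; apply: contraNF Qi => /eqP->.
have [Pi|NPi] := boolP (P i); last by rewrite nul // mulr0 mul0r.
rewrite (bigD1 i) //= mderivM mderivXU eqxx !mul1r nul ?mulr0 ?addr0 //.
by rewrite eqxx andbF.
Qed.

Lemma mulX_mderiv_prod_exp i k :
  'X_i * mderiv i ((\prod_j 'X_j) ^+ k) = k%:R * (\prod_j 'X_j) ^+ k :> {mpoly F[n]}.
Proof.
rewrite mderiv_exp mulrCA mulX_mderiv_prod mul1r.
by case: k => [|k]; rewrite ?mul0r // -mulrA -exprSr.
Qed.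

(** The invariants y_j over an arbitrary coefficient ring, with the exponent d of
    the last one as an independent parameter. *)
Definition invariant (r d : nat) (j : 'I_n) : {mpoly F[n]} :=
  if j.+1 == n then (\prod_i 'X_i) ^+ d else \sum_i 'X_i ^+ (j.+1 * r).

Definition invariant_jacobian (r d : nat) : 'M[{mpoly F[n]}]_n :=
  \matrix_(i, j) mderiv j (invariant r d i).

End EulerIdentities.

(** Once its column j is multiplied by x_j, the Jacobian matrix has the row
    (i+1) r x_j^((i+1) r) for i < m and the constant row d (x_1 ... x_n)^d at the
    bottom. Pulling out these scalars leaves a Vandermonde matrix in the x_j^r
    whose row of ones is the last one instead of the first: its rows are
    permuted by a cycle of length m + 1, which gives the sign (-1)^m. *)
Lemma mulX_det_invariant_jacobian (F : comNzRingType) (r d m : nat) :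
  let n := m.+1 in
  \prod_(i < n) 'X_i * \det (invariant_jacobian F n r d) =
  (-1) ^+ m * d%:R * r%:R ^+ m * m`!%:R * (\prod_(i < n) 'X_i) ^+ d
   * \prod_(i < n) \prod_(j < n | (i < j)%N) ('X_j ^+ r - 'X_i ^+ r).
Proof.
move=> n.
(* The cycle i |-> i + 1, sending the last index to 0. *)
pose s : {perm 'I_n} := lift_perm ord_max ord0 1.
pose t : 'rV[{mpoly F[n]}]_n := \row_i 'X_i ^+ r.
pose c (i : 'I_n) : {mpoly F[n]} :=
  if i == ord_max then d%:R * (\prod_i 'X_i) ^+ d else (i.+1)%:R * r%:R.
have E : invariant_jacobian F n r d *m diag_mx (\row_i 'X_i) =
   diag_mx (\row_i c i) *m (perm_mx s *m Vandermonde n t).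
  apply/matrixP => i j; rewrite mul_mx_diag mul_diag_mx -row_permE !mxE /c.
  rewrite mulrC /invariant eqSS -val_eqE /=.
  case: (unliftP ord_max i) => [k|] ->; last first.
    by rewrite eqxx mulX_mderiv_prod_exp lift_perm_id expr0 mulr1.
  rewrite lift_perm_lift perm1 lift_max (ltn_eqF (ltn_ord k)) /=.
  rewrite raddf_sum mulr_sumr (bigD1 j) //= big1 ?addr0 => [|l lj].
    by rewrite mulX_mderiv_exp eqxx mul1r -exprM natrM (mulnC r).
  by rewrite mulX_mderiv_exp eq_sym (negbTE lj) mul0r.
have := congr1 (fun M => \det M) E.
rewrite !det_mulmx !det_diag det_perm det_Vandermonde.
rewrite odd_lift_perm odd_perm1 !addbF signr_odd mulrC => {E}.
under eq_bigr do rewrite mxE.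
move=> ->; rewrite (eq_bigr (fun i => c i)); last by move=> i _; rewrite mxE.
rewrite big_ord_recr /= {2}/c eqxx.
have -> : \prod_(i < m) c (widen_ord (leqnSn m) i) = r%:R ^+ m * m`!%:R.
  rewrite -[X in _ ^+ X](card_ord m) -prodr_const.
  rewrite fact_prod big_add1 big_mkord natr_prod -big_split /=.
  apply: eq_bigr => i _; rewrite /c -val_eqE /= (ltn_eqF (ltn_ord i)) //.
  exact: mulrC.
have -> : \prod_(i < n) \prod_(j < n | (i < j)%N) (t 0 j - t 0 i) =
    \prod_(i < n) \prod_(j < n | (i < j)%N) ('X_j ^+ r - 'X_i ^+ r).
  by apply: eq_bigr => i _; apply: eq_bigr => j _; rewrite !mxE.
by ring.
Qed.

Lemma det_invariant_jacobian (F : idomainType) (r d n : nat) :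
    (0 < d)%N -> (0 < n)%N ->
  \det (invariant_jacobian F n r d)^T =
  (-1) ^+ n.-1 * d%:R * r%:R ^+ n.-1 * n.-1`!%:R * (\prod_(i < n) 'X_i ^+ d.-1)
   * \prod_(i < n) \prod_(j < n | (i < j)%N) ('X_j ^+ r - 'X_i ^+ r).
Proof.
case: d n => // d [//|m] _ _; rewrite det_tr.
have X0 : \prod_(i < m.+1) ('X_i : {mpoly F[m.+1]}) != 0.
  by apply/prodf_neq0 => i _; rewrite mpolyXU_neq0.
apply: (mulfI X0); rewrite mulX_det_invariant_jacobian /= prodrXl exprS; ring.
Qed.

(** * Proportional polynomials *)

Definition proportional (F : fieldType) (n : nat) (f g : {mpoly F[n]}) : Prop :=
  exists2 c, c != 0 & f = c *: g.

Section Proportional.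
Variables (F : fieldType) (n : nat).
Implicit Types f g h : {mpoly F[n]}.

Lemma proportional_refl f : proportional f f.
Proof. by exists 1; rewrite ?oner_neq0 ?scale1r. Qed.

Lemma proportional_sym f g : proportional f g -> proportional g f.
Proof.
by case=> c c0 ->; exists c^-1; rewrite ?invr_eq0 // scalerA mulVf ?scale1r.
Qed.

Lemma proportional_trans f g h :
  proportional f g -> proportional g h -> proportional f h.
Proof.
by case=> c c0 -> [d d0 ->]; exists (c * d); rewrite ?mulf_neq0 ?scalerA.
Qed.

Lemma proportionalM f1 g1 f2 g2 :
  proportional f1 g1 -> proportional f2 g2 -> proportional (f1 * f2) (g1 * g2).
Proof.
move=> [c c0 ->] [d d0 ->]; exists (c * d); rewrite ?mulf_neq0 //.
by rewrite -scalerAl -scalerAr scalerA.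
Qed.

Lemma proportional_prod (I : Type) (r : seq I) (P : pred I)
    (f g : I -> {mpoly F[n]}) :
    (forall i, P i -> proportional (f i) (g i)) ->
  proportional (\prod_(i <- r | P i) f i) (\prod_(i <- r | P i) g i).
Proof.
move=> fg; apply: (big_ind2 (@proportional F n)) => //.
  exact: proportional_refl.
by move=> *; exact: proportionalM.
Qed.
End Proportional.

Section CharZero.
Variable F : numFieldType.

Lemma subX_exp_neq0 (n r : nat) (i j : 'I_n) : (0 < r)%N -> i != j ->
  'X_i ^+ r - 'X_j ^+ r != 0 :> {mpoly F[n]}.
Proof.
move=> r0 ij; apply/eqP => /(congr1 (meval (fun k => (k == i)%:R))).
rewrite mevalB !rmorphXn /= !mevalXU meval0 eqxx eq_sym (negbTE ij).
by rewrite expr1n expr0n (gtn_eqF r0) subr0; apply/eqP/oner_neq0.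
Qed.

Lemma det_invariant_jacobian_proportional (r d n : nat) :
    (0 < r)%N -> (0 < d)%N -> (0 < n)%N ->
  proportional (\det (invariant_jacobian F n r d)^T)
    (\prod_(i < n) 'X_i ^+ d.-1 *
     \prod_(i < n) \prod_(j < n | (i < j)%N) ('X_i ^+ r - 'X_j ^+ r)).
Proof.
move=> r0 d0 n0; rewrite det_invariant_jacobian // -mulrA.
have [sgn sgn0 ->] : proportional
   (\prod_(i < n) \prod_(j < n | (i < j)%N) ('X_j ^+ r - 'X_i ^+ r) : {mpoly F[n]})
   (\prod_(i < n) \prod_(j < n | (i < j)%N) ('X_i ^+ r - 'X_j ^+ r)).
  apply: proportional_prod => i _; apply: proportional_prod => j _.
  by exists (-1); rewrite ?oppr_eq0 ?oner_neq0 // scaleN1r opprB.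
exists ((-1) ^+ n.-1 * d%:R * r%:R ^+ n.-1 * n.-1`!%:R * sgn).
  by rewrite !mulf_neq0 ?expf_neq0 ?oppr_eq0 ?oner_neq0 ?pnatr_eq0 -?lt0n ?fact_gt0.
rewrite -!mul_mpolyC !(rmorphM, rmorphXn, rmorphN1, rmorph_nat) /=.
by rewrite -!mulrA (mulrCA sgn%:MP).
Qed.

Lemma det_invariant_jacobian_neq0 (r d n : nat) :
    (0 < r)%N -> (0 < d)%N -> (0 < n)%N ->
  \det (invariant_jacobian F n r d)^T != 0.
Proof.
move=> r0 d0 n0; have [c c0 ->] := det_invariant_jacobian_proportional r0 d0 n0.
rewrite scaler_eq0 (negbTE c0) mulf_neq0 //; apply/prodf_neq0 => i _.
  by rewrite expf_neq0 // mpolyXU_neq0.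
apply/prodf_neq0 => j ij; apply: subX_exp_neq0 r0 _.
by rewrite -val_eqE neq_ltn ij.
Qed.
End CharZero.

(** * Roots of unity *)

Lemma expr1_neq0 (F : fieldType) (k : nat) (u : F) : (0 < k)%N -> u ^+ k = 1 -> u != 0.
Proof.
move=> k0; apply: contra_eq_neq => ->.
by rewrite expr0n (gtn_eqF k0) eq_sym oner_neq0.
Qed.

(** Homogenization of 'X^k - 1 = \prod_u ('X - u): evaluate at a / b and clear the
    denominators. *)
Lemma prod_sub_unity_roots (F K : fieldType) (iota : {rmorphism F -> K}) (k : nat)
    (us : seq F) (a b : K) :
  b != 0 -> \prod_(u <- us) ('X - u%:P) = 'X^k - 1 ->
  size us = k ->
  \prod_(u <- us) (a - iota u * b) = a ^+ k - b ^+ k.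
Proof.
move=> b0 /(congr1 (fun q => (map_poly iota q).[a / b])) + sz.
rewrite rmorph_prod rmorphB rmorph1 /= map_polyXn.
rewrite hornerD hornerN hornerXn hornerC horner_prod => /(congr1 ( *%R (b ^+ k))).
rewrite mulrBr mulr1 -exprMn mulrCA divff // mulr1 => <-.
have -> : b ^+ k = \prod_(u <- us) b.
  by rewrite big_const_seq count_predT iter_mulr_1 sz.
rewrite -big_split /=.
apply: eq_bigr => u _; rewrite rmorphB /= map_polyX map_polyC /=.
by rewrite hornerD hornerN hornerX hornerC mulrBr mulrCA divff // mulr1 (mulrC b).
Qed.

Lemma unity_roots (F : numClosedFieldType) (k : nat) : (0 < k)%N ->
  exists us : seq F, [/\ uniq us, size us = k, us =i [pred u | u ^+ k == 1] &
    \prod_(u <- us) ('X - u%:P) = 'X^k - 1].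
Proof.
move=> k0; have [us E] := closed_field_poly_normal ('X^k - 1 : {poly F}).
rewrite (monicP (monic_Xn_sub_1 F k0)) scale1r in E.
exists us; split=> //.
- by rewrite -separable_prod_XsubC -E separable_Xn_sub_1 // pnatr_eq0 -lt0n.
- have := congr1 (size \o @polyseq _) E.
  by rewrite /= size_prod_XsubC size_Xn_sub_1 // => -[].
- move=> u; rewrite inE -root_prod_XsubC -E rootE.
  by rewrite hornerD hornerN hornerXn hornerC subr_eq0.
Qed.

Lemma prod_sub_unity_rootsZ (F : fieldType) (n k : nat) (us : seq F) (i j : 'I_n) :
    \prod_(u <- us) ('X - u%:P) = 'X^k - 1 -> size us = k ->
  \prod_(u <- us) ('X_i - u *: 'X_j) = 'X_i ^+ k - 'X_j ^+ k :> {mpoly F[n]}.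
Proof.
move=> prod_us size_us; apply/eqP; rewrite -tofrac_eq; apply/eqP.
rewrite rmorph_prod rmorphB !rmorphXn /=.
rewrite -(prod_sub_unity_roots (@tofrac {mpoly F[n]} \o @mpolyC n F)
           _ _ prod_us size_us) /=.
  by apply: eq_bigr => u _; rewrite rmorphB /= -mul_mpolyC rmorphM.
by rewrite tofrac_eq0 mpolyXU_neq0.
Qed.

(** * Monomial matrices that differ from the identity by rank one *)

Section RankOne.
Variable F : fieldType.

Lemma rank1_mulmx m n (M : 'M[F]_(m, n)) : \rank M = 1%N ->
  exists (v : 'cV_m) (w : 'rV_n), M = v *m w.
Proof.
move=> rk; have := mulmx_base M; move: (col_base M) (row_base M).
by rewrite rk => v w <-; exists v, w.
Qed.

Lemma mulmx_rank1 m n (v : 'cV[F]_m) (w : 'rV_n) :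
  v *m w != 0 -> \rank (v *m w) = 1%N.
Proof.
move=> vw0; apply/eqP; rewrite eqn_leq lt0n mxrank_eq0 vw0 andbT.
exact: leq_trans (mxrankM_maxl _ _) (rank_leq_col _).
Qed.
End RankOne.

Section Reflections.
Variables (F : fieldType) (n : nat).
Implicit Types (i j : 'I_n) (u : F) (s : 'M[F]_n).

(** The diagonal matrix with u at i and ones elsewhere, written as the identity
    plus a matrix of rank one so that the root can be read off. *)
Definition diag_refl i u : 'M[F]_n := \matrix_(k, l)
  ((k == l)%:R + (u - 1) * (k == i)%:R * (l == i)%:R).

(** The transposition matrix of i and j with its entries (i, j) and (j, i)
    replaced by u and u^-1, again as the identity plus a column times a row. *)
Definition swap_refl i j u : 'M[F]_n := \matrix_(k, l)
  ((k == l)%:R + (u^-1 * (k == j)%:R - (k == i)%:R) * ((l == i)%:R - u * (l == j)%:R)).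

Lemma diag_reflE i u k l :
  diag_refl i u k l = if k == l then if k == i then u else 1 else 0.
Proof.
rewrite mxE; have [->|kl] := eqVneq k l.
  by case: (l == i); rewrite ?mulr1 ?mulr0 ?addr0 // addrC subrK.
have [ki|_] := eqVneq k i; last by rewrite mulr0 mul0r addr0.
by rewrite -ki (eq_sym l) (negbTE kl) mulr0 addr0.
Qed.

Lemma swap_reflE i j u k l : i != j -> u != 0 ->
  swap_refl i j u k l =
  if l == tperm i j k then if k == i then u else if k == j then u^-1 else 1 else 0.
Proof.
move=> ij u0; rewrite mxE; case: tpermP => [->|->|/eqP ki /eqP kj].
- rewrite eqxx (negbTE ij) (eq_sym i) mulr0 sub0r; case: (eqVneq l i) => [->|li].
    by rewrite (negbTE ij) mulr0 subr0 mulr1 addrN.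
  by case: (l == j); rewrite ?mulr0 ?mulr1 !sub0r ?oppr0 ?mulr0 ?addr0 ?add0r
    ?mulN1r ?opprK.
- rewrite eqxx (eq_sym j i) (negbTE ij) mulr1 subr0; case: (eqVneq l i) => [->|li].
    by rewrite (eq_sym j) (negbTE ij) mulr0 subr0 mulr1 add0r.
  rewrite sub0r (eq_sym j); case: (l == j); last by rewrite mulr0 oppr0 mulr0 addr0.
  by rewrite mulr1 mulrN mulVf // addrN.
- by rewrite (negbTE ki) (negbTE kj) mulr0 subr0 mul0r addr0 eq_sym; case: eqP.
Qed.

Lemma diag_refl_sub1 i u :
  diag_refl i u - 1%:M =
  (u - 1) *: ((delta_mx i 0 : 'cV_n) *m (delta_mx 0 i : 'rV_n)).
Proof.
apply/matrixP => k l; rewrite mul_delta_mx !mxE.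
by rewrite addrC addKr -mulrA -natrM mulnb.
Qed.

Lemma swap_refl_sub1 i j u :
  swap_refl i j u - 1%:M = (u^-1 *: delta_mx j 0 - delta_mx i 0 : 'cV_n) *m
    (delta_mx 0 i - u *: delta_mx 0 j : 'rV_n).
Proof.
apply/matrixP => k l; rewrite !mxE big_ord1 !mxE eqxx !andbT !andTb.
by rewrite addrC addKr.
Qed.

Lemma swap_reflC i j u : u != 0 -> swap_refl i j u = swap_refl j i u^-1.
Proof.
move=> u0; apply/matrixP => k l; rewrite !mxE invrK; congr (_ + _).
move: (k == j)%:R (k == i)%:R (l == i)%:R (l == j)%:R => a b c d.
by field.
Qed.

Lemma rank_diag_refl i u : u != 1 -> \rank (diag_refl i u - 1%:M) = 1%N.
Proof.
move=> u1; rewrite diag_refl_sub1 scalemxAl; apply: mulmx_rank1.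
rewrite -scalemxAl mul_delta_mx scaler_eq0 subr_eq0 (negbTE u1) /=.
by apply/eqP => /matrixP/(_ i i)/eqP; rewrite !mxE !eqxx oner_eq0.
Qed.

Lemma rank_swap_refl i j u : i != j -> \rank (swap_refl i j u - 1%:M) = 1%N.
Proof.
move=> ij; rewrite swap_refl_sub1; apply: mulmx_rank1.
apply/eqP => /matrixP/(_ i i)/eqP.
rewrite !mxE big_ord1 !mxE !eqxx (negbTE ij) /=.
by rewrite !mulr0 sub0r subr0 mulr1 oppr_eq0 oner_eq0.
Qed.

(** Write s = 1 + v w with v a column and w a row. If s has a nonzero entry at
    (i, j) with i <> j, the other entries of its row i and of its column j vanish;
    these equations force v and w to be supported on {i, j} and determine their
    entries up to a common scaling. If s is diagonal, v_k w_l = 0 for k <> l, so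
    that v and w are supported on one and the same index. *)
Lemma rank1_monomial_classify s :
    (forall i j l, s i j != 0 -> s i l != 0 -> j = l) ->
    (forall i k j, s i j != 0 -> s k j != 0 -> i = k) ->
    \rank (s - 1%:M) = 1%N ->
  (exists i u, u != 1 /\ s = diag_refl i u) \/
  (exists i j u, [/\ (i < j)%N, u != 0 & s = swap_refl i j u]).
Proof.
move=> row_s col_s rk.
have [v [w /matrixP Evw]] := rank1_mulmx rk.
have E k l : s k l = (k == l)%:R + v k 0 * w 0 l.
  by have /eqP := Evw k l; rewrite !mxE big_ord1 subr_eq addrC => /eqP.
case: (pickP (fun ij : 'I_n * 'I_n => (ij.1 != ij.2) && (s ij.1 ij.2 != 0)))
    => [[i j] /= /andP[nij sij]|offdiag].
  right; suff Es : s = swap_refl i j (s i j).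
    have [lt_ij|le_ji] := ltnP i j; first by exists i, j, (s i j).
    exists j, i, (s i j)^-1; rewrite -swap_reflC // invr_eq0; split=> //.
    by rewrite ltn_neqAle le_ji eq_sym nij.
  have row0 m : m != j -> s i m = 0.
    by move=> mj; apply: contraNeq mj => sim; rewrite (row_s _ _ _ sim sij).
  have col0 m : m != i -> s m j = 0.
    by move=> mi; apply: contraNeq mi => smj; rewrite (col_s _ _ _ smj sij).
  have vwij : v i 0 * w 0 j = s i j by rewrite E (negbTE nij) add0r.
  have vi0 : v i 0 != 0 by apply: contraNneq sij => v0; rewrite -vwij v0 mul0r.
  have wj0 : w 0 j != 0 by apply: contraNneq sij => v0; rewrite -vwij v0 mulr0.
  have vwi : v i 0 * w 0 i = -1.
    by apply/eqP; rewrite -subr_eq0 opprK addrC -(row0 i nij) E eqxx.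
  have vwj : v j 0 * w 0 j = -1.
    by apply/eqP; rewrite -subr_eq0 opprK addrC -(col0 j) 1?eq_sym // E eqxx.
  have wE l : w 0 l = w 0 i * ((l == i)%:R - s i j * (l == j)%:R).
    have [->|li] := eqVneq l i; first by rewrite (negbTE nij) mulr0 subr0 mulr1.
    rewrite sub0r; apply: (mulfI vi0); rewrite mulrA vwi mulN1r opprK.
    have [->|lj] := eqVneq l j; first by rewrite mulr1.
    by rewrite mulr0 -(row0 l lj) E eq_sym (negbTE li) add0r.
  have vE k : v k 0 = v i 0 * ((k == i)%:R - (s i j)^-1 * (k == j)%:R).
    have [->|ki] := eqVneq k i; first by rewrite (negbTE nij) mulr0 subr0 mulr1.
    rewrite sub0r; apply: (mulIf wj0); rewrite mulrAC vwij.
    have [->|kj] := eqVneq k j; first by rewrite vwj mulr1 mulrN divff.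
    by rewrite mulr0 oppr0 mulr0 -(col0 k ki) E (negbTE kj) add0r.
  apply/matrixP => k l; rewrite E vE wE mulrACA vwi mxE; congr (_ + _).
  by rewrite mulN1r -mulNr opprB.
left.
have off k l : k != l -> v k 0 * w 0 l = 0.
  move=> kl; have /= := offdiag (k, l); rewrite kl /= => /negbFE/eqP.
  by rewrite E (negbTE kl) add0r.
have [i [vi wi]] : exists i, v i 0 != 0 /\ w 0 i != 0.
  have : s - 1%:M != 0 by rewrite -mxrank_eq0 rk.
  case/matrix0Pn => k [l].
  rewrite Evw mxE big_ord1 mulf_eq0 negb_or => /andP[vk wl].
  have [kl|/off/eqP] := eqVneq k l; first by exists k; rewrite [in w 0 k]kl.
  by rewrite mulf_eq0 (negbTE vk) (negbTE wl).
exists i, (1 + v i 0 * w 0 i); split.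
  by rewrite -subr_eq0 addrC addKr mulf_neq0.
apply/matrixP => k l; rewrite E mxE [1 + _]addrC addrK; congr (_ + _).
have [->|ki] := eqVneq k i; last first.
  have /eqP := off k i ki; rewrite mulf_eq0 (negbTE wi) orbF => /eqP->.
  by rewrite mulr0 !mul0r.
have [->|li] := eqVneq l i; first by rewrite !mulr1.
by rewrite off 1?eq_sym // mulr0.
Qed.
End Reflections.

Lemma diag_refl_inj (F : fieldType) (n : nat) (i j : 'I_n) (u w : F) :
  u != 1 -> diag_refl i u = diag_refl j w -> (i, u) = (j, w).
Proof.
move=> u1 /matrixP/(_ i i); rewrite !diag_reflE eqxx.
by case: eqP => [-> -> //|_ /eqP]; rewrite (negbTE u1).
Qed.

Lemma swap_refl_inj (F : fieldType) (n : nat) (i j k l : 'I_n) (u w : F) :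
    (i < j)%N -> (k < l)%N -> u != 0 -> w != 0 ->
  swap_refl i j u = swap_refl k l w -> [/\ i = k, j = l & u = w].
Proof.
move=> ij kl u0 w0 /matrixP/(_ i j).
have nij : i != j by rewrite -val_eqE neq_ltn ij.
have nkl : k != l by rewrite -val_eqE neq_ltn kl.
rewrite !swap_reflE // tpermL !eqxx; case: eqP => [|_ /eqP];
  last by rewrite (negbTE u0).
case: tpermP => [-> -> ->|ik jl|_ _ ji]; first by rewrite eqxx.
  by move: ij; rewrite ik jl ltnNge ltnW.
by rewrite ji eqxx in nij.
Qed.

(** * The reflections of G(r,p,n) *)

Section GroupMembership.
Variables (R : realType) (n : nat).
Implicit Types (i j : 'I_n) (u : R[i]) (s g : 'M[R[i]]_n).

Lemma monomial_row g i j l : monomial_mx g -> g i j != 0 -> g i l != 0 -> j = l.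
Proof.
case/andP=> /forallP/(_ i)/cards1P[m Em] _ gij gil.
have in_m k : g i k != 0 -> k = m.
  by move=> gik; apply/set1P; rewrite -Em inE.
by rewrite (in_m j) // (in_m l).
Qed.

Lemma monomial_col g i k j : monomial_mx g -> g i j != 0 -> g k j != 0 -> i = k.
Proof.
case/andP=> _ /forallP/(_ j)/cards1P[m Em] gij gkj.
have in_m l : g l j != 0 -> l = m.
  by move=> glj; apply/set1P; rewrite -Em inE.
by rewrite (in_m i) // (in_m k).
Qed.

Lemma Grpn_perm (r p : nat) (sigma : {perm 'I_n}) g :
    (forall k l, (g k l != 0) = (l == sigma k)) ->
  Grpn r p g <-> (forall k, g k (sigma k) ^+ r = 1) /\
                 (\prod_k g k (sigma k)) ^+ (r %/ p) = 1.
Proof.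
move=> gE.
have -> : \prod_k g k (sigma k) = \prod_k \prod_(l | g k l != 0) g k l.
  by apply: eq_bigr => k _; rewrite (eq_bigl (pred1 (sigma k))) ?big_pred1_eq.
split=> [[_ g1 gd]|[g1 gd]]; first by split=> // k; apply: g1; rewrite gE.
split=> // [|k l]; last by rewrite gE => /eqP->.
apply/andP; split; apply/forallP => k.
  apply/cards1P; exists (sigma k); apply/setP => l.
  by rewrite !inE gE.
apply/cards1P; exists (sigma^-1 k)%g; apply/setP => l.
by rewrite !inE gE; apply/eqP/eqP => ->; rewrite ?permK ?permKV.
Qed.

Lemma diag_refl_Grpn (r p : nat) i u : (p %| r)%N -> u != 0 ->
  Grpn r p (diag_refl i u) <-> u ^+ (r %/ p) = 1.
Proof.
move=> pr u0.
have gE k l : (diag_refl i u k l != 0) = (l == (1%g : {perm 'I_n}) k).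
  rewrite (diag_reflE i u) perm1 (eq_sym l); case: (k == l); rewrite ?eqxx //.
  by case: (k == i); rewrite ?oner_neq0.
have prod_g : \prod_k diag_refl i u k ((1%g : {perm 'I_n}) k) = u.
  rewrite (bigD1 i) //= big1 => [|k ki]; rewrite perm1 (diag_reflE i u) eqxx.
    by rewrite mulr1.
  by rewrite (negbTE ki).
split=> [/(Grpn_perm r p gE)[_]|ud]; first by rewrite prod_g.
apply/(Grpn_perm r p gE); rewrite prod_g; split=> // k.
rewrite perm1 (diag_reflE i u) eqxx.
by case: ifP => _; rewrite ?expr1n // -(divnK pr) exprM ud expr1n.
Qed.

Lemma swap_refl_Grpn (r p : nat) i j u : i != j -> u != 0 ->
  Grpn r p (swap_refl i j u) <-> u ^+ r = 1.
Proof.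
move=> ij u0.
have ji : (j == i) = false by rewrite eq_sym (negbTE ij).
have gE k l : (swap_refl i j u k l != 0) = (l == tperm i j k).
  rewrite (swap_reflE _ _ ij u0); case: (l == _); rewrite ?eqxx //.
  by case: (k == i) => //; case: (k == j); rewrite ?invr_eq0 // oner_neq0.
have prod_g : \prod_k swap_refl i j u k (tperm i j k) = 1.
  rewrite (bigD1 i) //= (bigD1 j) /=; last by rewrite ji.
  rewrite big1 => [|k /andP[ki kj]]; rewrite !(swap_reflE _ _ ij u0) !eqxx.
    by rewrite ji mulr1 divff.
  by rewrite (negbTE ki) (negbTE kj).
split=> [/(Grpn_perm r p gE)[/(_ i)]|ur]; first by rewrite (swap_reflE _ _ ij u0) !eqxx.
apply/(Grpn_perm r p gE); rewrite prod_g.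
split=> [k|]; last by rewrite expr1n.
rewrite (swap_reflE _ _ ij u0) eqxx.
by case: ifP => _ //; case: ifP => _; rewrite ?expr1n // exprVn ur invr1.
Qed.

(** A swap with parameter u has product of entries u u^-1 = 1, so u is an arbitrary
    r-th root of unity; for a diagonal reflection this product is u itself. *)
Lemma reflectionP (r p : nat) s : (0 < r)%N -> (0 < r %/ p)%N -> (p %| r)%N ->
  reflection r p s <->
  (exists i u, [/\ u ^+ (r %/ p) = 1, u != 1 & s = diag_refl i u]) \/
  (exists i j u, [/\ (i < j)%N, u ^+ r = 1 & s = swap_refl i j u]).
Proof.
move=> r0 d0 pr.
split.
  case=> Gs rk; have [mon_s _ _] := Gs.
  case: (@rank1_monomial_classify _ _ s _ _ rk).
  - by move=> i j l; apply: monomial_row.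
  - by move=> i k j; apply: monomial_col.
  - move=> [i [u [u1 Es]]]; left; exists i, u; split=> //.
    have u0 : u != 0.
      apply: contraTneq mon_s => u0; apply/negP => /andP[/forallP/(_ i)].
      case/cards1P => m /setP/(_ m); rewrite !inE eqxx Es (diag_reflE i u) u0.
      by case: (i == m); rewrite ?eqxx.
    by apply/(diag_refl_Grpn i pr u0); rewrite -Es.
  - move=> [i [j [u [ij u0 Es]]]]; right; exists i, j, u; split=> //.
    have nij : i != j by rewrite -val_eqE neq_ltn ij.
    by apply/(swap_refl_Grpn r p nij u0); rewrite -Es.
case=> [[i [u [ud u1 ->]]]|[i [j [u [ij ur ->]]]]].
  split; last exact: rank_diag_refl.
  by apply/(diag_refl_Grpn i pr (expr1_neq0 d0 ud)).
have nij : i != j by rewrite -val_eqE neq_ltn ij.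
split; last exact: rank_swap_refl.
by apply/(swap_refl_Grpn r p nij (expr1_neq0 r0 ur)).
Qed.

End GroupMembership.

(** * Roots of reflections and the discriminant *)

Section LinearForms.
Variables (F : comNzRingType) (n : nat).

Definition linear_form (a : 'rV[F]_n) : {mpoly F[n]} := \sum_i a 0 i *: 'X_i.

Lemma mcoeff_linear_form a i : (linear_form a)@_U_(i) = a 0 i.
Proof.
rewrite raddf_sum /= (bigD1 i) //= big1 => [|j ji].
  by rewrite mcoeffZ mcoeffX eqxx mulr1 addr0.
rewrite mcoeffZ mcoeffX (_ : (_ == _) = false) ?mulr0 //.
apply: contraNF ji => /eqP/mnmP/(_ j).
by rewrite !mnm1E eqxx eq_sym; case: (j == i).
Qed.

Lemma homog1_linear_form (f : {mpoly F[n]}) : f \is 1.-homog ->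
  f = linear_form (\row_i f@_U_(i)).
Proof.
move=> hom_f; apply/mpolyP => m.
have [/mdeg1P[i /eqP->]|m1] := boolP (mdeg m == 1%N).
  by rewrite mcoeff_linear_form mxE.
rewrite (dhomog_nemf_coeff hom_f m1) raddf_sum big1 //= => i _.
rewrite mcoeffZ mcoeffX (_ : (_ == _) = false) ?mulr0 //.
by apply: contraNF m1 => /eqP<-; rewrite mdeg1.
Qed.

Lemma linear_formZ c a : linear_form (c *: a) = c *: linear_form a.
Proof.
rewrite /linear_form scaler_sumr; apply: eq_bigr => i _.
by rewrite mxE scalerA.
Qed.

Lemma linear_form_eq0 a : (linear_form a == 0) = (a == 0).
Proof.
apply/eqP/eqP => [a0|->]; last by rewrite -(scale0r 0) linear_formZ scale0r.
by apply/rowP => i; rewrite -mcoeff_linear_form a0 mcoeff0 mxE.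
Qed.

Lemma linear_form_inj : injective linear_form.
Proof.
by move=> a b ab; apply/rowP => i; rewrite -!mcoeff_linear_form ab.
Qed.

Lemma linear_form_comp (g : 'M[F]_n) a :
  linear_form a \mPo [tuple \sum_j g i j *: 'X_j | i < n] = linear_form (a *m g).
Proof.
rewrite /linear_form raddf_sum /=.
under eq_bigr => i _ do
  rewrite comp_mpolyZ comp_mpolyXU -tnth_nth tnth_mktuple scaler_sumr.
rewrite exchange_big /=; apply: eq_bigr => j _.
rewrite mxE scaler_suml; apply: eq_bigr => i _.
by rewrite scalerA.
Qed.
End LinearForms.

Section RootForm.
Variables (R : realType) (n : nat).

(** A root alpha, seen as a row vector a, satisfies a s = mu a with mu <> 1. If
    s = 1 + v w, then (mu - 1) a = (a v) w, so that a is a multiple of w. *)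
Lemma root_form_rank1 (s : 'M[R[i]]_n) (v : 'cV_n) (w : 'rV_n) alpha :
  s - 1%:M = v *m w -> root_form s alpha -> proportional alpha (linear_form w).
Proof.
move=> s1 [alpha0 /homog1_linear_form Ealpha [lambda lambda1]].
rewrite Ealpha; move: (\row_i _) Ealpha => a Ealpha.
rewrite /mpoly_act linear_form_comp -linear_formZ => /linear_form_inj Ea.
have {alpha0} a0 : a != 0 by rewrite -linear_form_eq0 -Ealpha.
(* The action uses the matrix invmx s, which is s itself if s is not invertible. *)
have [mu mu1 Emu] : exists2 mu, mu != 1 & a *m s = mu *: a.
  have [s_unit|s_unit] := boolP (s \in unitmx); last first.
    by exists lambda; rewrite // -Ea /invmx (negbTE s_unit).
  have Ea' : a = lambda *: (a *m s).
    by rewrite scalemxAl -Ea mulmxKV.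
  have l0 : lambda != 0 by apply: contraNneq a0 => l0; rewrite Ea' l0 scale0r.
  exists lambda^-1; first by rewrite -invr1 (inj_eq invr_inj).
  by rewrite [in RHS]Ea' scalerA mulVf ?scale1r.
have {}Ea : (mu - 1) *: a = (a *m v) 0 0 *: w.
  rewrite scalerBl scale1r -Emu -[X in _ - X]mulmx1 -mulmxBr s1 mulmxA.
  by rewrite {1}[a *m v]mx11_scalar mul_scalar_mx.
have mu0 : mu - 1 != 0 by rewrite subr_eq0.
exists ((mu - 1)^-1 * (a *m v) 0 0); last first.
  by rewrite -scalerA -linear_formZ -Ea linear_formZ scalerA mulVf ?scale1r.
rewrite mulf_neq0 ?invr_eq0 //; apply: contraNneq a0 => av0.
by rewrite -(scale1r a) -(mulVf mu0) -scalerA Ea av0 scale0r scaler0.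
Qed.

Lemma root_form_diag i u (alpha : {mpoly R[i][n]}) :
  root_form (diag_refl i u) alpha -> proportional alpha 'X_i.
Proof.
have := diag_refl_sub1 i u; rewrite scalemxAl => E /(root_form_rank1 E).
suff -> : linear_form (delta_mx 0 i) = 'X_i :> {mpoly R[i][n]} by [].
rewrite /linear_form (bigD1 i) //= big1 => [|j ji]; rewrite mxE ?eqxx.
  by rewrite scale1r addr0.
by rewrite (negbTE ji) scale0r.
Qed.

Lemma root_form_swap i j u (alpha : {mpoly R[i][n]}) :
  root_form (swap_refl i j u) alpha -> proportional alpha ('X_i - u *: 'X_j).
Proof.
move/(root_form_rank1 (swap_refl_sub1 i j u)).
suff -> : linear_form (delta_mx 0 i - u *: delta_mx 0 j)
  = 'X_i - u *: 'X_j :> {mpoly R[i][n]} by [].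
rewrite /linear_form.
under eq_bigr => k _ do rewrite !mxE /= scalerBl -scalerA.
rewrite sumrB -scaler_sumr; congr (_ - _ *: _).
  rewrite (bigD1 i) //= big1 => [|k ki]; first by rewrite eqxx scale1r addr0.
  by rewrite (negbTE ki) scale0r.
rewrite (bigD1 j) //= big1 => [|k kj]; first by rewrite eqxx scale1r addr0.
by rewrite (negbTE kj) scale0r.
Qed.

(** The reflections are enumerated as D, the diagonal ones, and S, the swaps. The
    d - 1 diagonal reflections at i all have the root x_i, and the r swaps of i and
    j have the roots x_i - u x_j, whose product over the r-th roots of unity u is
    x_i^r - x_j^r. *)
Lemma discriminant_proportional (r p : nat) (Delta : {mpoly R[i][n]}) :
    (0 < r)%N -> (0 < r %/ p)%N -> (p %| r)%N ->
  discriminant r p Delta ->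
  proportional Delta (\prod_(i < n) 'X_i ^+ (r %/ p).-1 *
     \prod_(i < n) \prod_(j < n | (i < j)%N) ('X_i ^+ r - 'X_j ^+ r)).
Proof.
move=> r0 d0 pr [refls [alpha [uniq_refls reflsE root_alpha ->]]].
have [us [uniq_us size_us usE prod_us]] := unity_roots R[i] r0.
have [ds [uniq_ds size_ds dsE _]] := unity_roots R[i] d0.
have ds1 : 1 \in ds by rewrite dsE inE expr1n.
pose pairs := enum [pred ij : 'I_n * 'I_n | (ij.1 < ij.2)%N].
pose D := [seq diag_refl i u | i <- enum 'I_n, u <- rem 1 ds].
pose S := [seq swap_refl ij.1 ij.2 u | ij <- pairs, u <- us].
have DP s : reflect
    (exists (i : 'I_n) (u : R[i]),
       [/\ u ^+ (r %/ p) = 1, u != 1 & s = diag_refl i u])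
    (s \in D).
  apply: (iffP allpairsP) => [[[i u] /= [_]]|[i [u [ud u1 ->]]]].
    rewrite (mem_rem_uniq _ uniq_ds) !inE dsE => /andP[u1 /eqP ud] ->.
    by exists i, u.
  exists (i, u); rewrite mem_enum (mem_rem_uniq _ uniq_ds) !inE dsE.
  by rewrite u1 inE ud eqxx.
have SP s : reflect
    (exists (i j : 'I_n) (u : R[i]),
       [/\ (i < j)%N, u ^+ r = 1 & s = swap_refl i j u])
    (s \in S).
  apply: (iffP allpairsP) => [[[[i j] u] /= []]|[i [j [u [ij ur ->]]]]].
    by rewrite mem_enum usE !inE => ij /eqP ur ->; exists i, j, u.
  by exists ((i, j), u); rewrite mem_enum usE !inE ij ur eqxx.
have perm_refls : perm_eq refls (D ++ S).
  apply: uniq_perm => //.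
    rewrite cat_uniq; apply/and3P; split.
    - apply: allpairs_uniq; rewrite ?enum_uniq ?rem_uniq //.
      move=> [i u] [j w] /allpairsP[[i1 u1] /= [_ + [-> ->]]] _.
      rewrite (mem_rem_uniq _ uniq_ds) !inE => /andP[u11 _].
      exact: diag_refl_inj.
    - apply/hasPn => _ /SP[i [j [u [ij ur ->]]]]; apply/negP.
      case/DP => k [w [_ _ /matrixP/(_ i j)/eqP]].
      have nij : i != j by rewrite -val_eqE neq_ltn ij.
      have u0 : u != 0 by apply: expr1_neq0 ur.
      rewrite (swap_reflE _ _ nij u0) tpermL !eqxx (diag_reflE k w).
      by rewrite (negbTE nij) (negbTE u0).
    - apply: allpairs_uniq; rewrite ?enum_uniq //.
      move=> [[i j] u] [[k l] w] /allpairsP[[[i1 j1] u1] /= [ij1 us1 [-> -> ->]]].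
      case/allpairsP=> [[[k1 l1] w1] /= [kl1 ws1 [-> -> ->]]].
      move: ij1 us1 kl1 ws1; rewrite !mem_enum !usE !inE.
      move=> ij /eqP/(expr1_neq0 r0) u0 kl /eqP/(expr1_neq0 r0) w0.
      by case/(swap_refl_inj ij kl u0 w0) => /= -> -> ->.
  move=> s; rewrite mem_cat; apply/idP/orP => [/reflsE|sDS]; last apply/reflsE.
    by case/(reflectionP s r0 d0 pr) => ?; [left; apply/DP|right; apply/SP].
  apply/(reflectionP s r0 d0 pr).
  by case: sDS => [/DP|/SP] ?; [left|right].
rewrite (perm_big _ perm_refls) big_cat /=; apply: proportionalM.
  rewrite big_allpairs_dep big_enum /=; apply: proportional_prod => i _.
  rewrite big_seq.
  apply: (@proportional_trans _ _ _
            (\prod_(u <- rem 1 ds | u \in rem 1 ds) 'X_i)).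
    apply: proportional_prod => u uds; apply: root_form_diag.
    apply: root_alpha; rewrite (perm_mem perm_refls) mem_cat.
    by rewrite allpairs_f ?mem_enum.
  rewrite -big_seq big_const_seq count_predT iter_mulr_1 size_rem // size_ds.
  exact: proportional_refl.
rewrite big_allpairs_dep big_enum /= pair_big_dep /=.
apply: proportional_prod => -[i j] /= ij.
rewrite -(prod_sub_unity_rootsZ i j prod_us size_us) !big_seq.
apply: proportional_prod => u uus; apply: root_form_swap.
apply: root_alpha; rewrite (perm_mem perm_refls) mem_cat.
apply/orP; right.
by apply: (allpairs_f (fun ij => swap_refl ij.1 ij.2) (x := (i, j)));
  rewrite ?mem_enum.
Qed.
End RootForm.

(** * Derivations of the field of rational functions *)

Local Open Scope quotient_scope.

Lemma frac_numden (S : idomainType) (f : {fraction S}) :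
  f = tofrac \n_(repr f) / tofrac \d_(repr f).
Proof.
have d0 : tofrac \d_(repr f) != 0 by rewrite tofrac_eq0 denom_ratioP.
apply: (mulIf d0); rewrite divfK // -{1}[f]reprK.
move: (repr f) => x; unlock tofrac; rewrite -[LHS]FracField.pi_mul.
apply/eqmodP; rewrite /= FracField.equivfE /FracField.mulf.
by rewrite !numden_Ratio ?mulf_neq0 ?denom_ratioP ?oner_neq0 // !mulr1 mulrC.
Qed.

(** The quotient rule does not depend on the fraction: a b' = a' b and the equality
    of the derivatives of both sides are the hypotheses. *)
Lemma quotient_rule_cross (S : comNzRingType) (a b a' b' Da Db Da' Db' : S) :
    a * b' = a' * b -> Da * b' + a * Db' = Da' * b + a' * Db ->
  (Da * b - a * Db) * (b' ^+ 2) = (Da' * b' - a' * Db') * (b ^+ 2).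
Proof.
move=> e1 e2.
have -> : (Da * b - a * Db) * b' ^+ 2 =
   (Da * b' + a * Db') * b * b' - (a * b') * (Db' * b + Db * b') by ring.
rewrite e1 e2; ring.
Qed.

Lemma quotient_ruleD (K : fieldType) (a b c d Da Db Dc Dd : K) :
    b != 0 -> d != 0 ->
  ((Da * d + a * Dd + (Dc * b + c * Db)) * (b * d)
     - (a * d + c * b) * (Db * d + b * Dd)) / (b * d) ^+ 2 =
  (Da * b - a * Db) / b ^+ 2 + (Dc * d - c * Dd) / d ^+ 2.
Proof. by move=> b0 d0; field; rewrite b0 d0. Qed.

Lemma quotient_ruleM (K : fieldType) (a b c d Da Db Dc Dd : K) :
    b != 0 -> d != 0 ->
  ((Da * c + a * Dc) * (b * d) - (a * c) * (Db * d + b * Dd)) / (b * d) ^+ 2 =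
  (Da * b - a * Db) / b ^+ 2 * (c / d) + a / b * ((Dc * d - c * Dd) / d ^+ 2).
Proof. by move=> b0 d0; field; rewrite b0 d0. Qed.

Section FracDeriv.
Variables (F : idomainType) (n : nat).
Local Notation K := {fraction {mpoly F[n]}}.
Implicit Types (f g : K) (a b : {mpoly F[n]}) (P Q : K -> K).

(** The derivation of F(x) extending mderiv i; over the complex
    numbers it is xderiv by definition. *)
Definition frac_deriv (i : 'I_n) f : K :=
  let a := \n_(repr f) in let b := \d_(repr f) in
  tofrac (mderiv i a * b - a * mderiv i b) / tofrac (b ^+ 2).

Definition frac_derivation P : Prop :=
  [/\ forall f g, P (f + g) = P f + P g,
      forall c f, P (tofrac c%:MP * f) = tofrac c%:MP * P f &
      forall f g, P (f * g) = P f * g + f * P g].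

Lemma frac_deriv_frac (i : 'I_n) a b : b != 0 ->
  frac_deriv i (tofrac a / tofrac b) =
  tofrac (mderiv i a * b - a * mderiv i b) / tofrac (b ^+ 2).
Proof.
move=> b0; rewrite /frac_deriv; set f := tofrac a / tofrac b.
have := frac_numden f; have := denom_ratioP (repr f).
move: (\n_ _) (\d_ _) => a' b' b'0 Ef.
apply/eqP; rewrite eqr_div ?tofrac_eq0 ?expf_neq0 // -!rmorphM tofrac_eq.
apply/eqP.
have e1 : a' * b = a * b'.
  apply/eqP; rewrite -tofrac_eq !rmorphM -eqr_div ?tofrac_eq0 //; apply/eqP.
  by rewrite -Ef.
by apply: (quotient_rule_cross e1); rewrite -!mderivM e1.
Qed.

Lemma frac_deriv_tofrac (i : 'I_n) a :
  frac_deriv i (tofrac a) = tofrac (mderiv i a).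
Proof.
have := frac_deriv_frac i a (oner_neq0 _).
by rewrite expr1n rmorph1 !divr1 -mpolyC1 mderivC mulr0 subr0 mpolyC1 mulr1.
Qed.

Lemma frac_deriv_derivation (i : 'I_n) : frac_derivation (frac_deriv i).
Proof.
have frac f : exists a b, b != 0 /\ f = tofrac a / tofrac b.
  exists \n_(repr f), \d_(repr f).
  by split; [exact: denom_ratioP|exact: frac_numden].
have t0 b : b != 0 -> tofrac b != 0 by rewrite tofrac_eq0.
have add_case f g : frac_deriv i (f + g) = frac_deriv i f + frac_deriv i g.
  have [a [b [b0 ->]]] := frac f; have [c [d [d0 ->]]] := frac g.
  rewrite addf_div ?t0 // -!rmorphM -rmorphD.
  rewrite !frac_deriv_frac ?mulf_neq0 // mderivD !mderivM.
  rewrite !(rmorphM, rmorphB, rmorphD, rmorphXn) /=.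
  by apply: quotient_ruleD; exact: t0.
have mul_case f g :
    frac_deriv i (f * g) = frac_deriv i f * g + f * frac_deriv i g.
  have [a [b [b0 ->]]] := frac f; have [c [d [d0 ->]]] := frac g.
  rewrite mulf_div -!rmorphM.
  rewrite !frac_deriv_frac ?mulf_neq0 // !mderivM.
  rewrite !(rmorphM, rmorphB, rmorphD, rmorphXn) /=.
  by apply: quotient_ruleM; exact: t0.
split=> // c f.
by rewrite mul_case frac_deriv_tofrac mderivC rmorph0 mul0r add0r.
Qed.

Lemma frac_derivation_sum (c : 'I_n -> K) :
  frac_derivation (fun f => \sum_i c i * frac_deriv i f).
Proof.
split=> [f g|z f|f g].
- rewrite -big_split; apply: eq_bigr => i _ /=.
  by have [-> _ _] := frac_deriv_derivation i; rewrite mulrDr.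
- rewrite mulr_sumr; apply: eq_bigr => i _ /=.
  by have [_ -> _] := frac_deriv_derivation i; rewrite mulrCA.
- rewrite mulr_suml mulr_sumr -big_split; apply: eq_bigr => i _ /=.
  have [_ _ ->] := frac_deriv_derivation i.
  by rewrite mulrDr mulrA (mulrCA f (c i)).
Qed.

Lemma frac_derivation1 P : frac_derivation P -> P 1 = 0.
Proof.
case=> _ _ PM; have := PM 1 1; rewrite !mulr1 mul1r => /eqP.
by rewrite -subr_eq0 opprD addNKr oppr_eq0 => /eqP.
Qed.

(** The elements on which P and Q agree contain the constants and the variables,
    and are closed under sums, products and quotients. *)
Lemma frac_derivation_eq P Q : frac_derivation P -> frac_derivation Q ->
  (forall i : 'I_n, P (tofrac 'X_i) = Q (tofrac 'X_i)) -> P = Q.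
Proof.
move=> dP dQ PQX; have [PD PZ PM] := dP; have [QD QZ QM] := dQ.
have PQ1 : P 1 = Q 1 by rewrite !frac_derivation1.
have PQM f g : P f = Q f -> P g = Q g -> P (f * g) = Q (f * g).
  by move=> ef eg; rewrite PM QM ef eg.
have PQexp f k : P f = Q f -> P (f ^+ k) = Q (f ^+ k).
  move=> ef; elim: k => [|k IH]; first by rewrite expr0.
  by rewrite exprS; apply: PQM.
have PQC c : P (tofrac c%:MP) = Q (tofrac c%:MP).
  by rewrite -[tofrac c%:MP]mulr1 PZ QZ PQ1.
have PQpoly a : P (tofrac a) = Q (tofrac a).
  elim/mpolyind: a => [|c m a _ _ IH].
    by have := PQC 0; rewrite mpolyC0.
  rewrite rmorphD PD QD IH -mul_mpolyC rmorphM; congr (_ + _).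
  apply: (PQM); first exact: PQC.
  rewrite mpolyXE_id rmorph_prod.
  apply: (big_ind (fun f => P f = Q f)) => // i _.
  by rewrite rmorphXn /=; apply: PQexp.
apply/funext => f; have := frac_numden f; have := denom_ratioP (repr f).
move: (\n_ _) (\d_ _) => a b b0 ->.
have tb0 : tofrac b != 0 by rewrite tofrac_eq0.
apply: (mulIf tb0).
have := PQpoly a; rewrite -{1 2}[tofrac a](divfK tb0).
move: (tofrac a / tofrac b) => g.
by rewrite PM QM PQpoly => /addIr ->.
Qed.

Lemma frac_derivationE P : frac_derivation P ->
  P = fun f => \sum_i P (tofrac 'X_i) * frac_deriv i f.
Proof.
move=> dP; apply: frac_derivation_eq => // [|j]; first exact: frac_derivation_sum.
rewrite (bigD1 j) //= big1 ?addr0 => [|i ij]; rewrite frac_deriv_tofrac mderivXU.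
  by rewrite eqxx rmorph1 mulr1.
by rewrite (negbTE ij) rmorph0 mulr0.
Qed.
End FracDeriv.

Section DualDerivation.
Variables (F : idomainType) (n : nat) (y : 'I_n -> {mpoly F[n]}).
Local Notation K := {fraction {mpoly F[n]}}.
Local Notation AK :=
  (map_mx (@tofrac {mpoly F[n]}) (\matrix_(i, j) mderiv j (y i))^T).

Definition dual_derivation (j : 'I_n) (P : K -> K) : Prop :=
  frac_derivation P /\ forall k, P (tofrac (y k)) = (j == k)%:R.

Lemma dual_derivation_invmx (j : 'I_n) : AK \in unitmx ->
  dual_derivation j (fun f : K => \sum_i invmx AK j i * frac_deriv i f).
Proof.
move=> uA; split=> [|k]; first exact: frac_derivation_sum.
have /matrixP/(_ j k) := mulVmx uA; rewrite !mxE => <-.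
by apply: eq_bigr => i _; rewrite frac_deriv_tofrac !mxE.
Qed.

(** Writing P = \sum_i P(x_i) d/dx_i, the conditions P(y_k) = [j = k] say that the
    row vector of the P(x_i), times AK, is the j-th unit row. *)
Lemma dual_derivationE (j : 'I_n) (P : K -> K) : AK \in unitmx ->
  dual_derivation j P -> P = fun f : K => \sum_i invmx AK j i * frac_deriv i f.
Proof.
move=> uA [/frac_derivationE EP Py].
pose v : 'rV[K]_n := \row_i P (tofrac 'X_i).
have Ev : v *m AK = row j 1%:M.
  apply/rowP => k; rewrite !mxE -Py EP.
  by apply: eq_bigr => i _; rewrite frac_deriv_tofrac !mxE.
have {}Ev : v = row j (invmx AK).
  by rewrite -[v](mulmxK uA) Ev -row_mul mul1mx.
rewrite {1}EP; apply/funext => f; apply: eq_bigr => i _.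
by move/rowP: Ev => /(_ i); rewrite !mxE => ->.
Qed.
End DualDerivation.

(** * Localization at the discriminant *)

Lemma invmx_map_adj (S : comUnitRingType) (K : fieldType) (iota : {rmorphism S -> K})
    (n : nat) (A : 'M[S]_n) i j :
  iota (\det A) != 0 ->
  invmx (map_mx iota A) i j = iota (\adj A i j) / iota (\det A).
Proof.
move=> det0; rewrite /invmx unitmxE det_map_mx unitfE det0.
by rewrite -map_mx_adj !mxE mulrC.
Qed.

(** By Cramer's rule the entries of the inverse of A are polynomials divided by
    Delta, up to a constant; this is why d/dy_j creates no pole outside the zeros
    of Delta. *)
Lemma dual_derivation_localized (F : fieldType) (n : nat) (y : 'I_n -> {mpoly F[n]})
    (Delta : {mpoly F[n]}) (c : F) (j : 'I_n) (a : {mpoly F[n]}) (k : nat) :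
  let A := (\matrix_(i, j) mderiv j (y i))^T in
  c != 0 -> Delta != 0 -> \det A = c *: Delta ->
  exists b l, \sum_i invmx (map_mx (@tofrac {mpoly F[n]}) A) j i
                * frac_deriv i (tofrac a / tofrac Delta ^+ k)
              = tofrac b / tofrac Delta ^+ l.
Proof.
move=> A c0 D0 detA; have tD0 : tofrac Delta != 0 by rewrite tofrac_eq0.
pose h i := mderiv i a * Delta ^+ k - a * mderiv i (Delta ^+ k).
exists (\sum_i (c^-1 *: (\adj A j i * h i))), (k * 2).+1.
rewrite rmorph_sum mulr_suml; apply: eq_bigr => i _.
rewrite invmx_map_adj detA; last first.
  by rewrite tofrac_eq0 scaler_eq0 (negbTE c0).
rewrite -rmorphXn frac_deriv_frac ?expf_neq0 // mulf_div -rmorphM /= -/(h i).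
apply/eqP; rewrite -!rmorphM -rmorphXn /= eqr_div; last first.
- by rewrite tofrac_eq0 expf_neq0.
- by rewrite tofrac_eq0 mulf_neq0 ?expf_neq0 // scaler_eq0 negb_or c0.
rewrite -!rmorphM tofrac_eq; apply/eqP.
by rewrite -!scalerAl -!scalerAr scalerA mulVf // scale1r exprS exprM.
Qed.

Lemma map_tofrac_unitmx (S : idomainType) (n : nat) (A : 'M[S]_n) :
  \det A != 0 -> map_mx (@tofrac S) A \in unitmx.
Proof. by move=> detA; rewrite unitmxE det_map_mx unitfE tofrac_eq0. Qed.

Section DYModule.
Variables (R : realType) (n r p : nat) (Delta : {mpoly R[i][n]}).

Hypothesis dy_stable :
  forall j P f, is_dy r p j P -> inOX Delta f -> inOX Delta (P f).

Lemma DY_stable (P : DY r p Delta) (f : OX Delta) : DYval P f \in OXpred Delta.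
Proof.
have /asboolP := valP f; have /asboolP := valP P.
rewrite /=; move: (OXval f) => {}f hP.
elim: hP f => [j|j Q dQ||c|Q1 Q2 _ IH1 _ IH2|Q1 Q2 _ IH1 _ IH2] f Of.
- case: Of => a [k ->]; apply/asboolP; exists (yinv R r p j * a), k.
  by rewrite rmorphM /= mulrA.
- by apply/asboolP; apply: dy_stable dQ _.
- case: Of => a [k ->]; apply/asboolP; exists a, (2 + k)%N.
  by rewrite mulrCA exprD [in RHS]invfM.
- case: Of => a [k ->]; apply/asboolP; exists (c%:MP * a), k.
  by rewrite rmorphM /= mulrA.
- by apply: rpredD; [apply: IH1|apply: IH2].
- by have /asboolP := IH2 f Of; exact: IH1.
Qed.

Definition DY_act (P : DY r p Delta) (f : OX Delta) : OX Delta :=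
  MkOX (DY_stable P f).

Lemma DY_actA (P Q : DY r p Delta) f : DY_act P (DY_act Q f) = DY_act (P * Q) f.
Proof. exact: val_inj. Qed.
Lemma DY_act0 f : DY_act 0 f = 0.
Proof. exact: val_inj. Qed.
Lemma DY_act1 : left_id 1 DY_act.
Proof. by move=> f; exact: val_inj. Qed.
Lemma DY_actDr : right_distributive DY_act +%R.
Proof. by move=> P f g; apply: val_inj; exact: DY_additive. Qed.
Lemma DY_actDl f : {morph DY_act^~ f : P Q / P + Q}.
Proof. by move=> P Q; exact: val_inj. Qed.

Definition DY_lmod : lmod_structure (DY r p Delta) (OX Delta) :=
  GRing.Nmodule_isLSemiModule.Build (DY r p Delta) (OX Delta)
    DY_actA DY_act0 DY_act1 DY_actDr DY_actDl.
End DYModule.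

(** * The theorem *)

Theorem lemma3p1 (R : realType) (r p n : nat)
    (hr : (0 < r)%N) (hp : (0 < p)%N) (hn : (0 < n)%N) (hpr : (p %| r)%N) :
  let d := (r %/ p)%N in
  let A : 'M[{mpoly R[i][n]}]_n := (jacobian R n r p)^T in
  let AK : 'M[Kx R n]_n := map_mx (@tofrac _) A in
  \det A = (-1) ^+ n.-1 * d%:R * r%:R ^+ n.-1 * (n.-1)`!%:R
           * (\prod_(i < n) 'X_i ^+ d.-1)
           * (\prod_(i < n) \prod_(j < n | (i < j)%N) ('X_j ^+ r - 'X_i ^+ r))
  /\
  forall Delta : {mpoly R[i][n]}, discriminant r p Delta ->
    (exists2 c : R[i], c != 0 & \det A = c *: Delta)
    /\
    exists M : lmod_structure (DY r p Delta) (OX Delta),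
      (forall (P : DY r p Delta) (f : OX Delta), OXval (lmod_act M P f) = P f)
      /\
      forall j : 'I_n,
        (exists! dy : DY r p Delta, is_dy r p j dy)
        /\
        forall (dy : DY r p Delta) (f : OX Delta), is_dy r p j dy ->
          OXval (lmod_act M dy f) = \sum_(i < n) invmx AK j i * xderiv i f.
Proof.
move=> d A AK.
have d0 : (0 < d)%N by rewrite divn_gt0 // dvdn_leq.
have detA := det_invariant_jacobian R[i] r d0 hn : \det A = _.
split=> // Delta discD.
have [c c0 AD] : exists2 c : R[i], c != 0 & \det A = c *: Delta.
  apply: (proportional_trans (det_invariant_jacobian_proportional R[i] hr d0 hn)).
  exact/proportional_sym/discriminant_proportional.
split; first by exists c.
have det0 : \det A != 0.
  exact: (det_invariant_jacobian_neq0 R[i] hr d0 hn).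
have D0 : Delta != 0 by apply: contraNneq det0 => D0; rewrite AD D0 scaler0.
have uA : AK \in unitmx := map_tofrac_unitmx det0.
have dyE j P (dP : is_dy r p j P) :
    P = fun f => \sum_(i < n) invmx AK j i * xderiv i f.
  exact: (dual_derivationE uA dP).
have dy_stable j P f : is_dy r p j P -> inOX Delta f -> inOX Delta (P f).
  move=> /dyE -> [a [k ->]].
  have [b [l Eb]] := dual_derivation_localized j a k c0 D0 AD.
  by exists b, l; exact: Eb.
exists (DY_lmod dy_stable); split=> // j.
have dyP : is_dy r p j (fun f => \sum_(i < n) invmx AK j i * xderiv i f).
  exact: (dual_derivation_invmx (y := yinv R r p) j uA).
split; last first.
  by move=> dy f /dyE E; exact: (congr1 (fun P => P (OXval f)) E).
have inD :
    (fun f => \sum_(i < n) invmx AK j i * xderiv i f) \in DYpred r p Delta.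
  by apply/asboolP; apply: DY_dy dyP.
exists (MkDY inD); split=> // dy /dyE E.
by apply: val_inj; rewrite /= E.
Qed.
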